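(* Let $f\in A_2$ be such that $f=\alpha_0u_0+\alpha_1u_1+\alpha_2u_0u_1$ for some $\alpha_0,\alpha_1,\alpha_2\in\mathbb{C}$. It holds that $$\mathsf{L}_{\mathsf{d}_{\mathcal{C}}}(f)=\max\{2|\alpha_0-\alpha_2|,\ 2|\alpha_0-\alpha_1|,\ 2|\alpha_0+\alpha_1|,\ 2|\alpha_0+\alpha_2|,\ 4|\alpha_1-\alpha_2|,\ 4|\alpha_1+\alpha_2|\}.$$
   Context: Convention: $\mathbb{N}$ contains $0$. The Cantor space is $\mathcal{C}=\{(x_n)_{n\in\mathbb{N}} : x_n\in\{0,1\} \text{ for all } n\}$ with the metric $\mathsf{d}_{\mathcal{C}}(x,y)=0$ if $x=y$ and $\mathsf{d}_{\mathcal{C}}(x,y)=2^{-\min\{m\in\mathbb{N} : x_m\neq y_m\}}$ otherwise. $C(\mathcal{C})$ is the C*-algebra of continuous functions $\mathcal{C}\to\mathbb{C}$ with pointwise operations, supremum norm and unit $1_{C(\mathcal{C})}$ (the constant function $1$). For $n\in\mathbb{N}$, $\eta_n\in C(\mathcal{C})$ is the coordinate map $\eta_n((z_m)_{m\in\mathbb{N}})=z_n$, and $u_n=2\eta_n-1_{C(\mathcal{C})}$ (so $u_n$ takes values in $\{-1,1\}$). $A_2=\operatorname{span}_{\mathbb{C}}\{1_{C(\mathcal{C})},u_0,u_1,u_0u_1\}$. The Lipschitz seminorm (with values in $[0,\infty]$) is, for $f\in C(\mathcal{C})$, $$\mathsf{L}_{\mathsf{d}_{\mathcal{C}}}(f)=\sup_{x,y\in\mathcal{C},\,x\neq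 y}\frac{|f(x)-f(y)|}{\mathsf{d}_{\mathcal{C}}(x,y)}.$$ *)

(* Defs.v *)
From HB Require Import structures.
From mathcomp Require Import all_boot all_order all_algebra.
From mathcomp Require Import all_classical all_reals all_analysis.
From mathcomp Require Import complex.

Set Implicit Arguments.
Unset Strict Implicit.
Unset Printing Implicit Defensive.

Import Order.TTheory GRing.Theory Num.Theory.
Import numFieldNormedType.Exports.

Local Open Scope classical_set_scope.
Local Open Scope ring_scope.

(* R[i] packed as a numClosedFieldType, so that it carries the topology given
   by the modulus. *)
Definition Cplx (R : realType) : numClosedFieldType := R[i]%C.

(* The R-valued modulus; the generic norm of R[i] is R[i]-valued. *)
Definition cmod (R : realType) (z : Cplx R) : R := ComplexField.Normc.normc z.

Lemma cmodE (R : realType) (z : Cplx R) : ((cmod z)%:C)%C = `|z|.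
Proof. by []. Qed.

(* continuousType X K as a subtype of X -> K, which gives it the pointwise
   commutative ring and K-module structures. *)

Section continuous_functions.
Context {K : numClosedFieldType} {X : topologicalType}.
Local Notation T := (continuousType X K).

Definition cts_pred : {pred X -> K} :=
  mem [set f : X -> K | continuous f].

Definition cts_sub (f : X -> K) (fP : f \in cts_pred) : T :=
  mkcts (set_mem fP : continuous f).

Lemma cts_rect (P : T -> Type) :
  (forall f (fP : f \in cts_pred), P (cts_sub fP)) -> forall u : T, P u.
Proof.
move=> Ksub [f [[fP]]].
have := Ksub f (mem_set fP).
by congr (P _); apply/continuousEP.
Qed.

Lemma cts_valP f (fP : f \in cts_pred) : cts_sub fP = f :> (X -> K).
Proof. by []. Qed.

HB.instance Definition _ := isSub.Build _ _ T cts_rect cts_valP.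

Lemma cts_subring_closed : subring_closed cts_pred.
Proof.
split=> [|f g|f g]; rewrite !inE/=.
- by move=> x; exact: cvg_cst.
- by move=> fc gc x; apply: cvgB; [exact: fc|exact: gc].
- by move=> fc gc x; apply: cvgM; [exact: fc|exact: gc].
Qed.
HB.instance Definition _ := GRing.isSubringClosed.Build _ cts_pred
  cts_subring_closed.
HB.instance Definition _ :=
  GRing.SubChoice_isSubComPzRing.Build (X -> K) cts_pred T
    (GRing.subringClosedP _).

Lemma cts_scaler_closed : GRing.scaler_closed cts_pred.
Proof.
move=> a f; rewrite !inE/= => fc x.
by apply: cvgZr; exact: fc.
Qed.
HB.instance Definition _ := GRing.isScaleClosed.Build _ _ cts_pred
  cts_scaler_closed.
HB.instance Definition _ := [SubZmodule_isSubLmodule of T by <:].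

Lemma ctsD (f g : T) x : (f + g) x = f x + g x. Proof. by []. Qed.
Lemma ctsB (f g : T) x : (f - g) x = f x - g x. Proof. by []. Qed.
Lemma ctsM (f g : T) x : (f * g) x = f x * g x. Proof. by []. Qed.
Lemma ctsZ (a : K) (f : T) x : (a *: f) x = a * f x. Proof. by []. Qed.
Lemma cts1 x : (1 : T) x = 1. Proof. by []. Qed.

End continuous_functions.

Definition lin_span (K : numClosedFieldType) (V : lmodType K) (s : seq V) :
    set V :=
  [set v | exists c : 'I_(size s) -> K, v = \sum_(i < size s) c i *: s`_i].

(* The points of the Cantor space, with false for 0 and true for 1. The
   parameter R is the type in which the distance takes its values; the library's
   cantor_space has the same points and topology but no chosen distance. *)
Definition cantor (R : realType) : Type := nat -> bool.

Section cantor_metric.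
Context {R : realType}.
Implicit Types x y z : cantor R.

HB.instance Definition _ := Choice.copy (cantor R) (nat -> bool).

Lemma cantor_neq x y : x <> y -> exists m, x m != y m.
Proof.
move=> xy; apply: contrapT => /forallNP h; apply: xy.
by apply/funext => m; apply/eqP/negPn/negP; exact: h.
Qed.

Definition first_diff x y (xy : x <> y) : nat := ex_minn (cantor_neq xy).

Definition dC x y : R :=
  match pselect (x = y) with
  | left _ => 0
  | right xy => 2 ^- first_diff xy
  end.

Lemma dCxx x : dC x x = 0.
Proof. by rewrite /dC; case: pselect. Qed.

Lemma dC_pos x y : dC x y = 0 -> x = y.
Proof.
rewrite /dC; case: pselect => // xy /eqP.
by rewrite invr_eq0 expf_eq0 pnatr_eq0 andbF.
Qed.

Lemma dC_leP x y n : reflect (forall m, (m < n)%N -> x m = y m) (dC x y <= 2 ^- n).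
Proof.
rewrite /dC; case: pselect => [->|xy].
  by rewrite invr_ge0 exprn_ge0 ?ler0n//; apply: ReflectT.
rewrite /first_diff; case: ex_minnP => k xyk kmin.
rewrite lef_pV2 ?posrE ?exprn_gt0 ?ltr0n// ler_eXn2l ?ltr1n//.
apply: (iffP idP) => [nk m mn|h].
  apply/eqP/negPn/negP => /kmin km.
  by have := leq_trans mn (leq_trans nk km); rewrite ltnn.
by rewrite leqNgt; apply/negP => /h /eqP; apply/negP.
Qed.

Lemma dC_sym x y : dC x y = dC y x.
Proof.
have [->//|/eqP xy] := eqVneq x y.
have yx : y <> x by move/esym.
rewrite /dC; do 2 case: pselect => // ?.
rewrite /first_diff; case: ex_minnP => k xyk kmin; case: ex_minnP => l yxl lmin.
congr (2 ^- _); apply/eqP; rewrite eqn_leq kmin ?lmin//.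
  by rewrite eq_sym.
by rewrite eq_sym.
Qed.

Lemma dC_triangle y x z : dC x z <= dC x y + dC y z.
Proof.
have dC_ge0 u v : 0 <= dC u v.
  by rewrite /dC; case: pselect => // ?; rewrite invr_ge0 exprn_ge0 ?ler0n.
have dCE u v : u <> v -> exists n, dC u v = 2 ^- n.
  by rewrite {1}/dC; case: pselect => // uv _; eexists.
have [->|/eqP /dCE[n xyn]] := eqVneq x y; first by rewrite lerDr.
have [->|/eqP /dCE[k yzk]] := eqVneq y z; first by rewrite lerDl.
apply: (@le_trans _ _ (2 ^- minn n k)).
  apply/dC_leP => m; rewrite leq_min => /andP[mn mk].
  have /dC_leP/(_ m mn) -> : dC x y <= 2 ^- n by rewrite xyn.
  by have /dC_leP/(_ m mk) : dC y z <= 2 ^- k by rewrite yzk.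
by rewrite xyn yzk minnE; case: (leqP n k) => nk;
  rewrite -minnE ?(minn_idPl nk) ?(minn_idPr (ltnW nk)) ?lerDl ?lerDr
    invr_ge0 exprn_ge0 ?ler0n.
Qed.

HB.instance Definition _ := isMetric.Build R (cantor R)
  dCxx dC_pos dC_sym dC_triangle.

Lemma mdist_cantor x y : mdist x y = dC x y. Proof. by []. Qed.

Lemma cantor_nbhsP x (A : set (cantor R)) :
  nbhs x A <-> exists n, [set y | forall m, (m < n)%N -> x m = y m] `<=` A.
Proof.
split=> [/nbhs_ballP[e /= e0 xeA]|[n nA]].
  have [n _ /(_ n (leqnn n)) /= ne] := near_infty_natSinv_expn_lt (PosNum e0).
  exists n => y xy; apply: xeA; rewrite ballEmdist /= mdist_cantor.
  by apply: le_lt_trans ne; rewrite div1r; apply/dC_leP.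
apply/nbhs_ballP; exists (2 ^- n); first by rewrite /= invr_gt0 exprn_gt0.
move=> y; rewrite ballEmdist /= mdist_cantor => /ltW /dC_leP xy.
exact: nA.
Qed.

Lemma cantor_space_nbhsE x : nbhs x = nbhs (x : cantor_space).
Proof.
apply/seteqP; split=> A.
  move=> /cantor_nbhsP[n nA]; apply: (filterS nA).
  elim: n {nA} => [|n ih]; first by apply: filterS filterT => y _ m.
  have xn : nbhs (x : cantor_space) [set y : cantor_space | x n = y n].
    exact: (@proj_continuous nat (fun=> bool) n x [set b | x n = b] _).
  apply: filterS (filterI ih xn) => y /= [xym xyn] m.
  by rewrite ltnS leq_eqVlt => /predU1P[->//|]; exact: xym.
suff: {ptws, (nbhs x : set_system (nat -> bool)) --> (x : nat -> bool)} by apply.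
apply/(pointwise_cvgP _ (nbhs_filter x)) => n B Bxn.
apply/cantor_nbhsP; exists n.+1 => y /(_ n (ltnSn n)) xyn.
by apply: nbhs_singleton; rewrite /= -xyn.
Qed.

End cantor_metric.

Section cantor_functions.
Context {R : realType}.

Definition eta_fun (n : nat) (z : cantor R) : Cplx R := (z n)%:R.

Lemma eta_continuous n : continuous (eta_fun n).
Proof.
move=> x A /= fxA; apply/cantor_nbhsP; exists n.+1 => y /(_ n (ltnSn n)) xy.
by apply: nbhs_singleton; rewrite /eta_fun -xy.
Qed.

Definition eta (n : nat) : continuousType (cantor R) (Cplx R) :=
  mkcts (@eta_continuous n).

Definition u (n : nat) : continuousType (cantor R) (Cplx R) :=
  2 *: eta n - 1.

Definition A2 : set (continuousType (cantor R) (Cplx R)) :=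
  lin_span [:: 1; u 0; u 1; u 0 * u 1].

(* Pairs x <> y exist, so this is the supremum in [0, +oo]. *)
Definition lip_dC (f : continuousType (cantor R) (Cplx R)) : \bar R :=
  ereal_sup [set (cmod (f p.1 - f p.2) / dC p.1 p.2)%:E |
    p in [set p : cantor R * cantor R | p.1 <> p.2]].

End cantor_functions.

Arguments eta R n : clear implicits.
Arguments u R n : clear implicits.
Arguments A2 R : clear implicits.

(* Main.v *)
(* f depends only on the first two coordinates. Pairs differing at coordinate 0
   are at distance 1 and yield the four terms with factor 2; pairs agreeing at 0
   and differing at 1 are at distance 1/2 and yield the two terms with factor 4;
   on all other pairs f takes equal values. *)

Require Import Defs.
From mathcomp Require Import all_boot all_order all_algebra.
From mathcomp Require Import all_classical all_reals all_analysis.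
From mathcomp Require Import complex ring.

Set Implicit Arguments.
Unset Strict Implicit.
Unset Printing Implicit Defensive.

Import Order.TTheory GRing.Theory Num.Theory.
Import numFieldNormedType.Exports.

Local Open Scope classical_set_scope.
Local Open Scope ring_scope.

Section cmod_dC.
Context {R : realType}.

Lemma cmodB (z w : Cplx R) : cmod (z - w) = cmod (w - z).
Proof. by apply: complexI; rewrite !cmodE distrC. Qed.

Lemma cmodMn2 (z : Cplx R) : cmod (z *+ 2) = 2 * cmod z.
Proof. by apply: complexI; rewrite rmorphM /= !cmodE normrMn rmorph_nat mulr_natl. Qed.

(** Gives [dC] a usable value without opening [ex_minn]: agreement below [n] bounds the distance
    above, and minimality of the first difference bounds it below. *)
Lemma dC_first_diff (x y : cantor R) n :
  (forall m, (m < n)%N -> x m = y m) -> x n != y n -> dC x y = 2 ^- n.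
Proof.
move=> xyn xn; apply: le_anti; apply/andP; split; first exact/dC_leP.
rewrite /dC; case: pselect => [xy|xy]; first by rewrite xy eqxx in xn.
rewrite /Defs.first_diff; case: ex_minnP => k _ /(_ n xn) kn.
by rewrite lef_pV2 ?posrE ?exprn_gt0 ?ltr0n// ler_eXn2l ?ltr1n.
Qed.

(** Serves the lower bound: a single pair contributes its quotient to the supremum, and [2 ^+ n] is
    the inverse of its distance. *)
Lemma le_lip_dC (f : continuousType (cantor R) (Cplx R)) (x y : cantor R) n :
  (forall m, (m < n)%N -> x m = y m) -> x n != y n ->
  ((2 ^+ n * cmod (f x - f y))%:E <= lip_dC f)%E.
Proof.
move=> xyn xn; apply: ereal_sup_ubound; exists (x, y) => /=.
  by move=> xy; rewrite xy eqxx in xn.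
by rewrite (dC_first_diff xyn xn) invrK mulrC.
Qed.

Lemma uE n (x : cantor R) : u R n x = if x n then 1 else - 1.
Proof.
have -> : u R n x = 2 * (x n)%:R - 1 by [].
by case: (x n); rewrite /=; ring.
Qed.

End cmod_dC.

Theorem theorem3p1 (R : realType) (f : continuousType (cantor R) (Cplx R))
    (a0 a1 a2 : Cplx R) :
  A2 R f ->
  f = a0 *: u R 0 + a1 *: u R 1 + a2 *: (u R 0 * u R 1) ->
  lip_dC f =
    (Num.max (2 * cmod (a0 - a2))
    (Num.max (2 * cmod (a0 - a1))
    (Num.max (2 * cmod (a0 + a1))
    (Num.max (2 * cmod (a0 + a2))
    (Num.max (4 * cmod (a1 - a2))
             (4 * cmod (a1 + a2)))))))%:E.
Proof.
move=> _ fE.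
have fv x :
      f x = a0 * (if x 0%N then 1 else - 1) + a1 * (if x 1%N then 1 else - 1)
        + a2 * ((if x 0%N then 1 else - 1) * (if x 1%N then 1 else - 1)).
  by rewrite fE !ctsD !ctsZ ctsM !uE.
(* Flipping [u 0] doubles [a0]. If [u 1] agrees at both points, [a1] cancels and [a2] survives;
   otherwise the product [u 0 * u 1] agrees, so [a2] cancels and [a1] survives. *)
have f_true_false (x y : cantor R) : x 0%N -> ~~ y 0%N ->
    cmod (f x - f y) = 2 * cmod (if x 1%N then if y 1%N then a0 + a2 else a0 + a1
                                 else if y 1%N then a0 - a1 else a0 - a2).
  move=> x0 /negbTE y0; rewrite -cmodMn2 !fv x0 y0; congr cmod.
  by case: (x 1%N); case: (y 1%N); ring.
(* The 2 on the left is the inverse of the distance 1/2; the other factor of the 4 is the jump of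
   [u 1] from -1 to 1. *)
have f_eq0 (x y : cantor R) : x 0%N = y 0%N -> x 1%N -> ~~ y 1%N ->
    2 * cmod (f x - f y) = 4 * cmod (if x 0%N then a1 + a2 else a1 - a2).
  move=> xy0 x1 /negbTE y1; rewrite (natrM _ 2 2) -mulrA -[in RHS]cmodMn2.
  by rewrite !fv -xy0 x1 y1; congr (2 * cmod _); case: (x 0%N); ring.
apply/eqP; rewrite eq_le; apply/andP; split; last first.
  (* Lower bound: the tail does not affect [f], so a constant tail will do, and each of the six
     terms comes from one pair of such points. *)
  pose pt (b c : bool) : cantor R := fun n => if n is 0 then b else c.
  have lip0 b c := @le_lip_dC _ f (pt true b) (pt false c) 0 (fun m => ltac:(by [])) isT.
  have lip1 b := @le_lip_dC _ f (pt b true) (pt b false) 1 (fun m => ltac:(by case: m)) isT.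
  rewrite !EFin_max !ge_max.
  move: (lip0 false false) (lip0 false true) (lip0 true false) (lip0 true true).
  move: (lip1 false) (lip1 true).
  rewrite !expr0 !mul1r !expr1 !f_eq0// !f_true_false//=.
  by move=> -> -> -> -> -> ->.
apply: ge_ereal_sup => _ [[x y] /= xy <-]; rewrite lee_fin.
(* The quotient is symmetric in [x] and [y], so [x] may be taken as the point with value [true] at
   the first of coordinates 0 and 1 where they differ, if any. *)
wlog : x y xy / [\/ x 0%N && ~~ y 0%N,
    x 0%N = y 0%N /\ x 1%N && ~~ y 1%N | x 0%N = y 0%N /\ x 1%N = y 1%N].
  move=> W; case x0: (x 0%N); case y0: (y 0%N); case x1: (x 1%N); case y1: (y 1%N);
    do ?[by apply: W => //; rewrite x0 y0 x1 y1; first [by constructor 1 | by constructor 2 | by constructor 3]];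
    rewrite cmodB dC_sym; apply: W; rewrite ?x0 ?y0 ?x1 ?y1; do ?[exact/nesym];
    first [by constructor 1 | by constructor 2].
case=> [/andP[x0 y0]|[xy0 /andP[x1 y1]]|[xy0 xy1]].
- rewrite (@dC_first_diff _ _ _ 0) ?x0 ?(negbTE y0)// invrK expr0 mulr1.
  rewrite f_true_false//.
  by case: (x 1%N); case: (y 1%N); rewrite !le_max lexx ?orbT.
- rewrite (@dC_first_diff _ _ _ 1) ?x1 ?(negbTE y1)//; last by case.
  rewrite invrK expr1 mulrC f_eq0//.
  by case: (x 0%N); rewrite !le_max lexx ?orbT.
(* Here the distance is unknown, but the numerator vanishes; the maximum is nonnegative through its
   first term. *)
- rewrite !fv xy0 xy1 subrr [cmod 0]ComplexField.Normc.normc0 mul0r.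
  by rewrite le_max mulr_ge0// -lecR cmodE normr_ge0.
Qed.
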